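(* Let $H$ be a (real or complex) Hilbert space whose dimension over $\mathbb{R}$ is greater than or equal to two. Then: (a) $\Phi_H^S(\delta)=\sqrt{2-\sqrt{4-2\delta}}$ for every $\delta\in(0,2)$. (b) For $\delta\in(0,1]$, $\Phi_H(\delta)=\max\left\{\delta,\sqrt{2-\sqrt{4-2\delta}}\right\}$; for $\delta\in(1,2)$, $\Phi_H(\delta)=\sqrt{\delta}$.
   Context: For a (real or complex) Banach space $X\neq\{0\}$, $B_X$ and $S_X$ denote its closed unit ball and unit sphere, $X^*$ its topological dual, and $\Pi(X):=\{(x,x^* )\in X\times X^* : \|x\|=\|x^*\|=x^*(x)=1\}$. The Bishop-Phelps-Bollobás modulus $\Phi_X:(0,2)\to[0,\infty)$ is defined as follows: $\Phi_X(\delta)$ is the infimum of those $\varepsilon>0$ such that for every $(x,x^* )\in B_X\times B_{X^*}$ with $\operatorname{Re} x^*(x)>1-\delta$ there is $(y,y^* )\in\Pi(X)$ with $\|x-y\|<\varepsilon$ and $\|x^*-y^*\|<\varepsilon$. The spherical Bishop-Phelps-Bollobás modulus $\Phi_X^S:(0,2)\to[0,\infty)$ is defined in the same way with $B_X\times B_{X^*}$ replaced by $S_X\times S_{X^*}$. *)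

(* Defs.v *)
From mathcomp Require Import all_boot all_order all_algebra.
From mathcomp Require Import sesquilinear.
From mathcomp Require Import complex.
From mathcomp Require Import all_classical all_reals all_analysis.

Set Implicit Arguments.
Unset Strict Implicit.
Unset Printing Implicit Defensive.

Import Order.TTheory GRing.Theory Num.Theory.
Import numFieldNormedType.Exports.

Local Open Scope classical_set_scope.
Local Open Scope ring_scope.

Variant scalar_kind := RealScalars | ComplexScalars.

Definition scalars (R : realType) (k : scalar_kind) : numFieldType :=
  match k with
  | RealScalars => R
  | ComplexScalars => R[i]
  end.

Definition re (R : realType) (k : scalar_kind) : scalars R k -> R :=
  match k return scalars R k -> R with
  | RealScalars => fun z => z
  | ComplexScalars => fun z => complex.Re z
  end.

Definition of_real (R : realType) (k : scalar_kind) : R -> scalars R k :=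
  match k return R -> scalars R k with
  | RealScalars => fun a => a
  | ComplexScalars => fun a => real_complex R a
  end.

Definition scalar_conj (R : realType) (k : scalar_kind) : scalars R k -> scalars R k :=
  match k return scalars R k -> scalars R k with
  | RealScalars => fun z => z
  | ComplexScalars => fun z => conjc z
  end.

Section BishopPhelpsBollobas.
Variables (R : realType) (k : scalar_kind).
Variable X : completeNormedModType (scalars R k).

(* The library norm is valued in the scalar field, always at a real point;
   [re] reads it back in R. *)
Definition rnorm (x : X) : R := re `|x|.

(* An element of the topological dual of X is a linear form
   f : {linear X -> (scalars R k)^o} together with [continuous f]. The
   supremum below is the dual norm only for such an f: [sup] is 0 on sets that
   are not bounded above. *)
Definition dual_norm (f : X -> scalars R k) : R :=
  sup [set re `|f x| | x in [set x : X | rnorm x <= 1]].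

Definition norming_pair (y : X) (ys : {linear X -> (scalars R k)^o}) : Prop :=
  [/\ continuous ys, rnorm y = 1, dual_norm ys = 1 & ys y = 1].

Definition in_balls (x : X) (xs : {linear X -> (scalars R k)^o}) : Prop :=
  [/\ continuous xs, rnorm x <= 1 & dual_norm xs <= 1].

Definition in_spheres (x : X) (xs : {linear X -> (scalars R k)^o}) : Prop :=
  [/\ continuous xs, rnorm x = 1 & dual_norm xs = 1].

Definition bpb_inf (D : X -> {linear X -> (scalars R k)^o} -> Prop)
    (delta : R) : R :=
  inf [set eps : R | 0 < eps /\
    forall (x : X) (xs : {linear X -> (scalars R k)^o}),
      D x xs -> re (xs x) > 1 - delta ->
      exists (y : X) (ys : {linear X -> (scalars R k)^o}),
        [/\ norming_pair y ys, rnorm (x - y) < eps & dual_norm (xs \- ys) < eps]].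

Definition bpb_modulus (delta : R) : R := bpb_inf in_balls delta.

Definition spherical_bpb_modulus (delta : R) : R := bpb_inf in_spheres delta.

(* Two vectors of X are linearly independent over R, also when X is complex. *)
Definition real_dim_ge2 : Prop :=
  exists u v : X, forall a b : R,
    of_real k a *: u + of_real k b *: v = 0 -> a = 0 /\ b = 0.

End BishopPhelpsBollobas.

(* Main.v *)
(** By the Riesz theorem a functional of norm at most one is [ip _ z] with [z] in
the unit ball, a norming pair is [(y, ip _ y)] with [y] a unit vector, and only
the real inner product [<x, z> = re (ip x z)] matters: [eps] is admissible when
all admissible [x], [z] with [<x, z> > 1 - delta] have a unit vector [y] within
distance [eps] of both.

For unit vectors, and for [delta <= 1], [y] bisects the angle between [x] and
[z]. With [a = |x|] and [p = <x, z>] this gives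
[|x - y|^2 <= 1 + a^2 - sqrt (2a^2 + 2ap)], a convex function of [a] on [[p, 1]]
with endpoint values [(1 - p)^2] and [2 - sqrt (2 + 2p)]. For [delta > 1], a
unit vector equidistant from [x] and [z] is within [sqrt (1 - p)] of both.

A smaller [eps] is refuted by unit vectors with [<x, z> = (2 - eps^2)^2 / 2 - 1],
by [(x, (1 - eps) x)], and by [(x, - s x)] with [s = max (eps^2 - 1) 0],
respectively for the three expressions in the theorem. *)

From HB Require Import structures.
Require Import Defs.
From mathcomp Require Import all_boot all_order all_algebra.
From mathcomp Require Import sesquilinear complex.
From mathcomp Require Import all_classical all_reals all_analysis.
From mathcomp Require Import ring lra.

Set Implicit Arguments.
Unset Strict Implicit.
Unset Printing Implicit Defensive.

Import Order.TTheory GRing.Theory Num.Theory.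
Import numFieldNormedType.Exports.

Local Open Scope ring_scope.

(** * Real and complex scalars, handled through their real parts *)

Section Scalars.
Context {R : realType} {k : scalar_kind}.
Implicit Types (a b : R) (z w : scalars R k).

Lemma reD z w : re (z + w) = re z + re w.
Proof. by case: k z w => // -[? ?] [? ?]. Qed.

Lemma reN z : re (- z) = - re z.
Proof. by case: k z => // -[]. Qed.

Lemma re0 : re (0 : scalars R k) = 0.
Proof. by case: k. Qed.

Lemma re1 : re (1 : scalars R k) = 1.
Proof. by case: k. Qed.

Lemma re_of_real a : re (of_real k a) = a.
Proof. by case: k. Qed.

Lemma re_of_realM a z : re (of_real k a * z) = a * re z.
Proof. by case: k z => // -[? ?] /=; rewrite mul0r subr0. Qed.

Lemma re_conj z : re (scalar_conj z) = re z.
Proof. by case: k z => // -[]. Qed.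

Lemma of_realM a b : of_real k (a * b) = of_real k a * of_real k b.
Proof. by case: k => //=; rewrite rmorphM. Qed.

Lemma of_real1 : of_real k (1 : R) = 1.
Proof. by case: k. Qed.

Lemma of_real0 : of_real k (0 : R) = 0.
Proof. by case: k. Qed.

Lemma ltr_of_real a b : (of_real k a < of_real k b) = (a < b).
Proof. by case: k => //=; rewrite ltcR. Qed.

Lemma ler_of_real a b : (of_real k a <= of_real k b) = (a <= b).
Proof. by case: k => //=; rewrite lecR. Qed.

Lemma of_real_re_ge0 z : 0 <= z -> of_real k (re z) = z.
Proof. by case: k z => /= [//|[a b]]; rewrite lecE /= => /andP[/eqP ->]. Qed.

Lemma of_real_normK z : of_real k (re `|z|) = `|z|.
Proof. exact: of_real_re_ge0. Qed.

Lemma re_le_norm z : re z <= re `|z|.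
Proof.
case: k z => /= [z|[a b]]; first exact: ler_norm.
by rewrite /= (le_trans (ler_norm _)) // -sqrtr_sqr ler_wsqrtr // lerDl sqr_ge0.
Qed.

Lemma phase z : exists2 u, `|u| = 1 & u * z = `|z|.
Proof.
have [->|z0] := eqVneq z 0; first by exists 1; rewrite ?normr1 ?mulr0 ?normr0.
exists (`|z| / z); last by rewrite divfK.
by rewrite normrM normfV normr_id divff // normr_eq0.
Qed.

End Scalars.

(** * The real inner product space underlying the Hilbert space *)

Section RealInnerProduct.
Context {R : realType} {k : scalar_kind}.
Context {H : completeNormedModType (scalars R k)}.
Variable ip : {dot H for @scalar_conj R k}.
Hypothesis norm_ip : forall x : H, `|x| ^+ 2 = ip x x.
Implicit Types (x y z u v h : H) (a b : R).

Definition rscale a x : H := of_real k a *: x.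
Definition rdot x y : R := re (ip x y).

Local Notation "a *r x" := (rscale a x) (at level 40).
Local Notation "<| x , y |>" := (rdot x y).

Lemma rdotC x y : <|x, y|> = <|y, x|>.
Proof. by rewrite /rdot hermitian_subproof expr0 mul1r re_conj. Qed.

Lemma rdotDl x y z : <|x + y, z|> = <|x, z|> + <|y, z|>.
Proof. by rewrite /rdot linearDl reD. Qed.

Lemma rdotNl x z : <|- x, z|> = - <|x, z|>.
Proof. by rewrite /rdot linearNl reN. Qed.

Lemma rdotZl a x z : <|a *r x, z|> = a * <|x, z|>.
Proof. by rewrite /rdot linearZl_LR /= re_of_realM. Qed.

Lemma rdotDr x y z : <|x, y + z|> = <|x, y|> + <|x, z|>.
Proof. by rewrite rdotC rdotDl !(rdotC x). Qed.

Lemma rdotNr x z : <|x, - z|> = - <|x, z|>.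
Proof. by rewrite rdotC rdotNl rdotC. Qed.

Lemma rdotZr a x z : <|x, a *r z|> = a * <|x, z|>.
Proof. by rewrite rdotC rdotZl rdotC. Qed.

Definition rdotE := (rdotDl, rdotDr, rdotNl, rdotNr, rdotZl, rdotZr).

Lemma of_real_rnorm x : of_real k (rnorm x) = `|x|.
Proof. exact: of_real_re_ge0. Qed.

Lemma rnorm_ge0 x : 0 <= rnorm x.
Proof. by rewrite -(@ler_of_real _ k) of_real0 of_real_rnorm. Qed.

Lemma rdotxx x : <|x, x|> = rnorm x ^+ 2.
Proof.
by rewrite /rdot -norm_ip -of_real_rnorm !expr2 -of_realM re_of_real.
Qed.

Lemma rdotxx_ge0 x : 0 <= <|x, x|>.
Proof. by rewrite rdotxx sqr_ge0. Qed.

Lemma rnormE x : rnorm x = Num.sqrt <|x, x|>.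
Proof. by rewrite rdotxx sqrtr_sqr ger0_norm ?rnorm_ge0. Qed.

Lemma rnorm_eq0 x : rnorm x = 0 -> x = 0.
Proof.
by move=> x0; apply/eqP; rewrite -normr_eq0 -of_real_rnorm x0 of_real0.
Qed.

Lemma rnorm_le x a : 0 <= a -> (rnorm x <= a) = (<|x, x|> <= a ^+ 2).
Proof. by move=> a0; rewrite rdotxx ler_pXn2r // nnegrE rnorm_ge0. Qed.

Lemma rnorm_lt x a : 0 <= a -> (rnorm x < a) = (<|x, x|> < a ^+ 2).
Proof. by move=> a0; rewrite rdotxx ltr_pXn2r // nnegrE rnorm_ge0. Qed.

Lemma rnorm_eq1 x : <|x, x|> = 1 -> rnorm x = 1.
Proof. by rewrite rnormE => ->; rewrite sqrtr1. Qed.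

Lemma rdot_gt0 x : x != 0 -> 0 < <|x, x|>.
Proof.
move=> x0; rewrite lt_def rdotxx_ge0 andbT rdotxx sqrf_eq0.
by apply: contra_neq x0 => /rnorm_eq0.
Qed.

(** The squared norm of [|y| x - |x| y] is [2 |x| |y| (|x| |y| - <x, y>)]; for nonzero vectors the
    positive factor cancels. *)
Lemma rdot_CauchySchwarz x y : <|x, y|> <= rnorm x * rnorm y.
Proof.
have := rdotxx_ge0 (rnorm y *r x - rnorm x *r y).
rewrite !rdotE !rdotxx (rdotC y x).
have [-> _|x0] := eqVneq x 0.
  rewrite /rdot linear0l re0 mulr_ge0 ?rnorm_ge0 //.
have [-> _|y0] := eqVneq y 0.
  rewrite /rdot linear0r re0 mulr_ge0 ?rnorm_ge0 //.
have rnorm_gt0 z : z != 0 -> 0 < rnorm z.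
  by move=> /rdot_gt0; rewrite rnormE sqrtr_gt0.
move=> xy; rewrite -subr_ge0.
have xy0 : 0 < 2 * (rnorm x * rnorm y) by rewrite !mulr_gt0 ?rnorm_gt0.
rewrite -(pmulr_rge0 _ xy0); apply: le_trans xy _.
by rewrite le_eqVlt; apply/orP; left; apply/eqP; ring.
Qed.

Lemma rnormalize x : x != 0 -> rnorm ((rnorm x)^-1 *r x) = 1.
Proof.
move=> /rdot_gt0; rewrite rdotxx => x0; apply: rnorm_eq1.
by rewrite !rdotE rdotxx; field; apply: contraTneq x0 => ->; rewrite expr0n ltxx.
Qed.


(** * Riesz representation and the dual norm *)

Lemma rnormZ a x : rnorm (a *r x) = `|a| * rnorm x.
Proof.
by rewrite !rnormE !rdotE mulrA -expr2 sqrtrM ?sqr_ge0 // sqrtr_sqr.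
Qed.

(* The quadratic functional [|v|^2 / 2 - re (f v)] is bounded below; the
   parallelogram law makes its minimising sequences Cauchy, and the first
   variation at the limit identifies it as the representing vector. *)
Lemma riesz_re (f : {linear H -> (scalars R k)^o}) : continuous f ->
  exists w, forall h, re (f h) = <|h, w|>.
Proof.
move=> /linear_bounded_continuous /linear_boundedP /pinfty_ex_gt0 [c0 c00 fc0].
pose c := re c0.
have fc x : re (f x) <= c * rnorm x.
  apply: (le_trans (re_le_norm (f x : scalars R k))).
  rewrite -(@ler_of_real _ k) of_real_normK.
  have c0E : of_real k c = c0.
    exact: of_real_re_ge0 (ltW c00).
  by rewrite of_realM c0E of_real_rnorm fc0.
have fD x y : re (f (x + y)) = re (f x) + re (f y) by rewrite linearD reD.
have fZ a x : re (f (a *r x)) = a * re (f x).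
  by rewrite /rscale linearZ /= re_of_realM.
pose J v := <|v, v|> / 2 - re (f v).
have hasJ : has_inf (range J).
  split; first by exists (J 0), 0.
  exists (- c ^+ 2 / 2) => _ [v _ <-]; rewrite /J rdotxx.
  have := fc v; have := sqr_ge0 (rnorm v - c); nra.
pose m := inf (range J).
have Jm v : m <= J v by apply: ge_inf; [case: hasJ|exists v].
have minimizing n : exists x, J x < m + n.+1%:R^-1.
  have [|_ [x _ <-] xm] := @inf_adherent _ (range J) (n.+1%:R^-1) _ hasJ.
    by rewrite invr_gt0 ltr0n.
  by exists x.
have [v vJ] := boolp.choice minimizing.
(* By the parallelogram law [J (v i) + J (v j) - 2 J ((v i + v j) / 2)] equals [|v i - v j|^2 / 4],
   and [J] is at least [m] at the midpoint. *)
have vv i j : <|v i - v j, v i - v j|> <= 4 * (i.+1%:R^-1 + j.+1%:R^-1).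
  have := Jm (2^-1 *r (v i + v j)); move: (vJ i) (vJ j).
  rewrite /J !rdotE fZ fD (rdotC (v j) (v i)).
  move: (i.+1%:R^-1) (j.+1%:R^-1) (re (f (v i))) (re (f (v j))) => p q r s.
  move: <|v i, v i|> <|v i, v j|> <|v j, v j|> => a b d; lra.
have vc : cvgn v.
  apply/cauchy_cvgP/cauchy_exP => e e0.
  have eE := of_real_re_ge0 (ltW e0); set e' := re e in eE.
  have e'0 : 0 < e' by rewrite -(@ltr_of_real _ k) eE of_real0.
  have e8 : 0 < e' ^+ 2 / 8 by rewrite divr_gt0 ?exprn_gt0.
  have [N _ NP] := near_infty_natSinv_lt (PosNum e8).
  exists (v N); exists N => // n /= Nn.
  rewrite -ball_normE /ball_ /= -eE -of_real_rnorm ltr_of_real.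
  rewrite rnorm_lt ?ltW//; apply: le_lt_trans (vv N n) _.
  have /= := NP N (leqnn N); have /= := NP n Nn.
  move: (N.+1%:R^-1) (n.+1%:R^-1) => p q; lra.
pose w := limn v.
have vw e : 0 < e -> exists n, n.+1%:R^-1 < e /\ rnorm (w - v n) < e.
  move=> e0; have eK : 0 < of_real k e by rewrite -(@of_real0 R k) ltr_of_real.
  have [N1 _ N1P] := near_infty_natSinv_lt (PosNum e0).
  have [N2 _ N2P] := (@cvgrPdist_lt _ _ _ _ _ _ _).1 vc (of_real k e) eK.
  exists (maxn N1 N2); split; first exact: N1P (leq_maxl _ _).
  rewrite -(@ltr_of_real _ k) of_real_rnorm.
  exact: N2P (leq_maxr _ _).
exists w => h.
(* The right-hand side is [J (w + t h) - J w]. Its sign is found along [v n], up to an error [e]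
   made of the minimality defect of [v n], at most [e / q], and the effect of [|w - v n|], at most
   [T * (e / q)]. *)
have var t : 0 <= t * (<|h, w|> - re (f h)) + t ^+ 2 * (<|h, h|> / 2).
  rewrite -[leRHS]addr0; apply/ler_addgt0Pr => e e0.
  set T := `|t| * rnorm h.
  have T0 : 0 <= T by rewrite mulr_ge0 ?rnorm_ge0.
  pose q := 1 + T.
  have q0 : 0 < q by rewrite ltr_pwDl.
  have [n [ne wn]] := vw (e / q) (divr_gt0 e0 q0).
  have := Jm (v n + t *r h); have := vJ n.
  rewrite /J !rdotE fD fZ (rdotC (v n) h).
  have : - (t * (<|h, w|> - <|h, v n|>)) <= T * (e / q).
    have -> : - (t * (<|h, w|> - <|h, v n|>)) = <|(- t) *r h, w - v n|>.
      by rewrite !rdotE; ring.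
    apply: le_trans (rdot_CauchySchwarz _ _) _.
    by rewrite rnormZ normrN ler_wpM2l // ltW.
  have eE : e = e / q + T * (e / q).
    by rewrite -[X in X + _]mul1r -mulrDl mulrC divfK ?gt_eqF.
  move: (n.+1%:R^-1) (re (f (v n))) (re (f h)) ne => p r s.
  move: (T * (e / q)) (e / q) eE => S E.
  move: <|v n, v n|> <|h, v n|> <|h, w|> <|h, h|> => a b d g; lra.
have Q0 := rdotxx_ge0 h; set Q := <|h, h|> in Q0 var.
set d := <|h, w|> - re (f h) in var.
apply/eqP; rewrite -subr_eq0 -oppr_eq0 opprB -/d -sqrf_eq0 eq_le sqr_ge0 andbT.
have Q1 : 0 < Q + 1 by rewrite ltr_wpDl.
(* The denominator [Q + 1] stays nonzero when [h = 0]. For this [t] nonnegativity of the variation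
   forces [d = 0]. *)
have := var (- d / (Q + 1)).
rewrite -(pmulr_rge0 _ (exprn_gt0 2 Q1)).
have -> : (Q + 1) ^+ 2 * (- d / (Q + 1) * d + (- d / (Q + 1)) ^+ 2 * (Q / 2)) =
    - (d ^+ 2 * (1 + Q / 2)) by field; rewrite gt_eqF.
have := sqr_ge0 d; nra.
Qed.

(** Multiplying [h] by a unimodular scalar turns [f h] into its modulus and keeps the norm of [h],
    so Cauchy-Schwarz for the real part suffices. *)
Lemma re_norm_le_representing (f : H -> scalars R k) w :
    (forall c h, f (c *: h) = c * f h) -> (forall h, re (f h) = <|h, w|>) ->
  forall h, re `|f h| <= rnorm h * rnorm w.
Proof.
move=> fZ fw h; have [u u1 <-] := phase (f h).
rewrite -fZ fw (le_trans (rdot_CauchySchwarz _ _)) //.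
by rewrite /rnorm normrZ u1 mul1r.
Qed.

(** The upper bound is attained at [w / |w|] when [w] is nonzero. *)
Lemma dual_norm_representing (f : H -> scalars R k) w :
    (forall c h, f (c *: h) = c * f h) -> (forall h, re (f h) = <|h, w|>) ->
  dual_norm f = rnorm w.
Proof.
move=> fZ fw; have fle := re_norm_le_representing fZ fw.
set E := [set re `|f x| | x in [set x : H | rnorm x <= 1]]%classic.
have Eub : ubound E (rnorm w).
  by move=> _ [x x1 <-]; rewrite (le_trans (fle x)) // ler_piMl ?rnorm_ge0.
have rnorm0 : rnorm (0 : H) = 0 by rewrite /rnorm normr0 re0.
apply/eqP; rewrite eq_le; apply/andP; split.
  by apply: ge_sup => //; exists (re `|f 0|), 0 => //=; rewrite rnorm0.
have [->|w0] := eqVneq w 0.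
  rewrite rnorm0; apply: le_trans (_ : re `|f 0| <= _).
    by rewrite -(@ler_of_real _ k) of_real_normK of_real0.
  by apply: ub_le_sup; [exists (rnorm w) | exists 0; rewrite //= rnorm0].
pose x := (rnorm w)^-1 *r w.
have wx : <|x, w|> = rnorm w.
  rewrite /x rdotZl rdotxx expr2 mulKf //.
  by apply: contra_neq w0 => /rnorm_eq0.
rewrite -[leLHS]wx -fw (le_trans (re_le_norm _)) //.
by apply: ub_le_sup; [exists (rnorm w) | exists x; rewrite //= rnormalize].
Qed.

Lemma linear_form_of_vector y : exists f : {linear H -> (scalars R k)^o},
  continuous f /\ forall h, f h = ip h y.
Proof.
have ipl : linear_for *:%R (fun h => ip h y : (scalars R k)^o).
  by move=> c u v; rewrite linearDl linearZl_LR.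
pose L := GRing.isLinear.Build _ _ _ _ (fun h => ip h y : (scalars R k)^o) ipl.
pose f : {linear H -> (scalars R k)^o} := HB.pack (fun h => ip h y : (scalars R k)^o) L.
exists f; split=> //.
apply/linear_bounded_continuous/linear_boundedP.
near=> r => x.
apply: le_trans (_ : `|y| * `|x| <= _); last first.
  by rewrite ler_wpM2r //; near: r; exact: nbhs_pinfty_ge.
rewrite mulrC -!of_real_rnorm -of_realM -of_real_normK ler_of_real.
apply: re_norm_le_representing => //.
by move=> c h; rewrite linearZ.
Unshelve. all: by end_near. Qed.

(** * Translation of the moduli into a condition on vectors *)

Definition vector_bpb (D : R -> R -> Prop) (delta eps : R) :=
  forall x z, D (rnorm x) (rnorm z) -> 1 - delta < <|x, z|> ->
  exists y, [/\ rnorm y = 1, rnorm (x - y) < eps & rnorm (z - y) < eps].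

(** This equality case of Cauchy-Schwarz forces the vector representing a norming functional at [y]
    to be [y] itself, so one vector stands for the whole norming pair. *)
Lemma rdot_unit_eq x y : rnorm x = 1 -> rnorm y = 1 -> <|x, y|> = 1 -> x = y.
Proof.
move=> x1 y1 xy; apply/eqP; rewrite -subr_eq0; apply/eqP/rnorm_eq0.
rewrite rnormE !rdotE (rdotC y x) xy !rdotxx x1 y1.
by rewrite (_ : _ - _ + _ = 0) ?sqrtr0 //; ring.
Qed.

Lemma bpb_condition (D : R -> R -> Prop)
    (D' : H -> {linear H -> (scalars R k)^o} -> Prop) delta eps :
    (forall x (f : {linear H -> (scalars R k)^o}),
       D' x f <-> continuous f /\ D (rnorm x) (dual_norm f)) ->
  (forall x (f : {linear H -> (scalars R k)^o}), D' x f -> re (f x) > 1 - delta ->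
    exists y (g : {linear H -> (scalars R k)^o}),
     [/\ norming_pair y g, rnorm (x - y) < eps & dual_norm (f \- g) < eps])
  <-> vector_bpb D delta eps.
Proof.
have homog (f : {linear H -> (scalars R k)^o}) c h : f (c *: h) = c * f h.
  by rewrite linearZ.
have dualB (f g : {linear H -> (scalars R k)^o}) z y :
    (forall h, re (f h) = <|h, z|>) -> (forall h, re (g h) = <|h, y|>) ->
    dual_norm (f \- g) = rnorm (z - y).
  move=> fz gy; apply: dual_norm_representing => [c h|h] /=.
    by rewrite !homog mulrBr.
  by rewrite reD reN fz gy rdotDr rdotNr.
move=> D'E; split=> [P x z Dxz xz|P x f /D'E[cf Dxf] fx].
  have [f [cf fz]] := linear_form_of_vector z.
  have fz' h : re (f h) = <|h, z|> by rewrite fz.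
  have [||y [g [[cg y1 g1 gy] xy fg]]] := P x f.
  - by apply/D'E; rewrite (dual_norm_representing (homog f) fz').
  - by rewrite fz'.
  have [w gw] := riesz_re cg.
  rewrite (dual_norm_representing (homog g) gw) in g1.
  have yw : y = w by apply: rdot_unit_eq => //; rewrite -gw gy re1.
  by exists y; split=> //; rewrite -(dualB f g) // yw.
have [z fz] := riesz_re cf.
rewrite (dual_norm_representing (homog f) fz) in Dxf.
have [|y [y1 xy zy]] := P x z Dxf; first by rewrite -fz.
have [g [cg gy]] := linear_form_of_vector y.
have gy' h : re (g h) = <|h, y|> by rewrite gy.
exists y, g; split=> //; last by rewrite (dualB f g z y).
split=> //; first by rewrite (dual_norm_representing (homog g) gy').
by rewrite gy -norm_ip -of_real_rnorm y1 of_real1 expr1n.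
Qed.

(** The infimum is a minimum in every case below: the strict condition [1 - delta < <x, z>] leaves
    room for strict distance bounds at the optimal radius itself. *)
Lemma bpb_infE (D : R -> R -> Prop)
    (D' : H -> {linear H -> (scalars R k)^o} -> Prop) delta e :
    (forall x (f : {linear H -> (scalars R k)^o}),
       D' x f <-> continuous f /\ D (rnorm x) (dual_norm f)) ->
    0 < e -> vector_bpb D delta e ->
    (forall eps, 0 < eps -> vector_bpb D delta eps -> e <= eps) ->
  bpb_inf D' delta = e.
Proof.
move=> D'E e0 De lb; rewrite /bpb_inf; set E := (X in inf X).
have Ee : E e by split=> //; apply/(bpb_condition _ _ D'E).
have Elb : lbound E e.
  by move=> eps [eps0 /(bpb_condition _ _ D'E)]; exact: lb.
apply/eqP; rewrite eq_le; apply/andP; split.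
  by apply: ge_inf => //; exists e.
by apply: lb_le_inf => //; exists e.
Qed.

Lemma vector_bpb_sub (D E : R -> R -> Prop) delta eps :
  (forall a b, D a b -> E a b) ->
  vector_bpb E delta eps -> vector_bpb D delta eps.
Proof. by move=> DE Ee x z /DE; exact: Ee. Qed.

Definition both_eq1 a b := a = 1 /\ b = 1.
Definition both_le1 a b := a <= 1 /\ b <= 1.

Lemma rdot_subxx x y : <|x - y, x - y|> = <|x, x|> - 2 * <|x, y|> + <|y, y|>.
Proof. by rewrite !rdotE (rdotC y x); ring. Qed.

(** * Constructions in real dimension at least two, and lower bounds *)

Section Dimension.
Hypothesis dimH : real_dim_ge2 H.

(** The combination [<x, v> u - <x, u> v] is orthogonal to [x]. If it vanishes, independence gives
    [<x, u> = 0], and [u] serves instead. *)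
Lemma exists_orthogonal_unit x : exists n, rnorm n = 1 /\ <|x, n|> = 0.
Proof.
have ortho_unit n : n != 0 -> <|x, n|> = 0 -> exists n, rnorm n = 1 /\ <|x, n|> = 0.
  move=> n0 xn; exists ((rnorm n)^-1 *r n).
  by rewrite rnormalize // rdotZr xn mulr0.
have [u [v uv]] := dimH.
have u0 : u != 0.
  apply/eqP => u0; have [|] := uv 1 0; last by move/eqP; rewrite oner_eq0.
  by rewrite u0 scaler0 of_real0 scale0r addr0.
have [e0|e0] := eqVneq (<|x, v|> *r u + (- <|x, u|>) *r v) 0.
  by have [_ /eqP] := uv _ _ e0; rewrite oppr_eq0 => /eqP; exact: ortho_unit.
by apply: ortho_unit e0 _; rewrite !rdotE; ring.
Qed.

Lemma exists_unit : exists n : H, rnorm n = 1.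
Proof. by have [n []] := exists_orthogonal_unit 0; exists n. Qed.

Lemma exists_unit_pair c : c ^+ 2 <= 1 ->
  exists x z, [/\ rnorm x = 1, rnorm z = 1 & <|x, z|> = c].
Proof.
move=> c1; have [x x1] := exists_unit.
have [n [n1 xn]] := exists_orthogonal_unit x.
exists x, (c *r x + Num.sqrt (1 - c ^+ 2) *r n); split=> //; last first.
  by rewrite !rdotE rdotxx x1 xn; ring.
apply: rnorm_eq1; rewrite !rdotE !rdotxx x1 n1 (rdotC n x) xn.
have := sqr_sqrtr (_ : 0 <= 1 - c ^+ 2); rewrite subr_ge0 => /(_ c1).
by move: (Num.sqrt _) => s; lra.
Qed.

(* [y] is the point of the sphere equidistant from [x] and [z] that lies on the
   same side of their midpoint as a normal [n] to [x - z]. *)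
Lemma equidistant_unit x z : rnorm x <= 1 -> rnorm z <= 1 ->
  exists y, [/\ rnorm y = 1, rnorm (x - y) ^+ 2 <= 1 - <|x, z|>
                           & rnorm (z - y) ^+ 2 <= 1 - <|x, z|>].
Proof.
rewrite !rnorm_le // expr1n => x1 z1.
have [n [n1 dn mn]] : exists n, [/\ rnorm n = 1, <|x - z, n|> = 0 & 0 <= <|x, n|>].
  have [n [n1 dn]] := exists_orthogonal_unit (x - z).
  have [xn|xn] := leP 0 <|x, n|>; first by exists n.
  exists (- n); rewrite !rdotNr dn oppr0 oppr_ge0 (ltW xn).
  by split=> //; rewrite /rnorm normrN.
have zn : <|z, n|> = <|x, n|>.
  by apply/esym/eqP; rewrite -subr_eq0 -rdotNl -rdotDl dn.
have nn : <|n, n|> = 1 by rewrite rdotxx n1 expr1n.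
(* [M] is the squared norm of the midpoint of [x] and [z], and [r] below is the nonnegative root of
   [r^2 + 2 r m = 1 - M], which puts the midpoint plus [r n] on the sphere. *)
set m := <|x, n|> in mn zn; set M := (<|x, x|> + <|z, z|> + 2 * <|x, z|>) / 4.
have M1 : M <= 1.
  by have := rdotxx_ge0 (x - z); rewrite rdot_subxx /M; lra.
have mM0 : 0 <= m ^+ 2 + 1 - M by rewrite -addrA addr_ge0 ?sqr_ge0 ?subr_ge0.
pose r := Num.sqrt (m ^+ 2 + 1 - M) - m.
have r0 : 0 <= r.
  rewrite subr_ge0 -[leLHS]ger0_norm // -sqrtr_sqr ler_sqrt //.
  by rewrite -addrA lerDl subr_ge0.
have rE : r ^+ 2 + 2 * r * m = 1 - M.
  have := sqr_sqrtr mM0; rewrite /r; move: (Num.sqrt _) => s; lra.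
(* Both squared distances equal [1 - <x, z> - 2 r m]. *)
have rm0 : 0 <= r * m by rewrite mulr_ge0.
exists (2^-1 *r (x + z) + r *r n); split.
- apply: rnorm_eq1; rewrite !rdotE (rdotC n x) (rdotC n z) (rdotC z x) zn nn -/m.
  by move: rE; rewrite /M; lra.
- rewrite -rdotxx rdot_subxx !rdotE.
  rewrite (rdotC n x) (rdotC n z) (rdotC z x) zn nn -/m.
  by move: rE; rewrite /M; lra.
- rewrite -rdotxx rdot_subxx !rdotE.
  rewrite (rdotC n x) (rdotC n z) (rdotC z x) zn nn -/m.
  by move: rE; rewrite /M; lra.
Qed.

Lemma vector_bpb_ball_sqrt delta : 0 < delta ->
  vector_bpb both_le1 delta (Num.sqrt delta).
Proof.
move=> d0 x z [x1 z1] xz; have [y [y1 xy zy]] := equidistant_unit x1 z1.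
exists y; split=> //; rewrite rnorm_lt ?sqrtr_ge0 // sqr_sqrtr ?ltW //.
  by rewrite rdotxx (le_lt_trans xy) //; lra.
by rewrite rdotxx (le_lt_trans zy) //; lra.
Qed.

Lemma vector_bpb_sphere_ge delta eps : 0 < delta < 2 -> 0 < eps ->
  vector_bpb both_eq1 delta eps -> Num.sqrt (2 - Num.sqrt (4 - 2 * delta)) <= eps.
Proof.
move=> /andP[d0 d2] eps0 Deps; rewrite leNgt; apply/negP => lt_eps.
set S := Num.sqrt (4 - 2 * delta) in lt_eps.
have S0 : 0 <= S by exact: sqrtr_ge0.
have SE : S ^+ 2 = 4 - 2 * delta by rewrite sqr_sqrtr //; lra.
have eps2 : eps ^+ 2 < 2 - S.
  have := sqrtr_ge0 (2 - S); have := lt_trans eps0 lt_eps.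
  rewrite sqrtr_gt0 => /ltW /sqr_sqrtr <- _.
  by rewrite ltr_pXn2r // nnegrE ltW // (lt_trans eps0).
have eps2_gt0 : 0 < eps ^+ 2 by rewrite exprn_gt0.
set s := 2 - eps ^+ 2; have sS : S < s by rewrite /s; lra.
have s2 : s < 2 by rewrite /s; lra.
(* This cosine gives [|x + z|^2 = 2 + 2 c = s^2]. A unit [y] within [eps] of both vectors has
   [<x, y>] and [<z, y>] above [s / 2], so [<x + z, y>] exceeds [|x + z|]. *)
pose c := s ^+ 2 / 2 - 1.
have s0 : 0 <= s := le_trans S0 (ltW sS).
have s_sq : S ^+ 2 < s ^+ 2 < 4.
  by rewrite (_ : 4 = 2 ^+ 2) ?ltr_pXn2r ?nnegrE ?sS //; ring.
have c1 : c ^+ 2 <= 1.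
  have : 0 <= (1 - c) * (1 + c) by apply: mulr_ge0; rewrite /c; lra.
  by lra.
have cd : 1 - delta < c by rewrite /c; lra.
have [x [z [x1 z1 xz]]] := exists_unit_pair c1.
have [] := Deps x z; [by split | by rewrite xz|].
move=> y [y1]; rewrite !(rnorm_lt _ (ltW eps0)) !rdot_subxx !rdotxx x1 z1 y1.
have := rdot_CauchySchwarz (x + z) y.
have -> : rnorm (x + z) = s.
  rewrite rnormE !rdotE !rdotxx x1 z1 (rdotC z x) xz.
  rewrite (_ : _ + _ = s ^+ 2) ?sqrtr_sqr ?ger0_norm //.
  by rewrite /c; field.
by rewrite y1 rdotDl /s; lra.
Qed.

(** If [eps < delta], the point [(1 - eps) x] has distance at least [eps] from every unit vector,
    while its product with [x] is [1 - eps > 1 - delta]. The bound [delta <= 1] makes [1 - eps]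
    nonnegative. *)
Lemma vector_bpb_ball_ge delta eps : delta <= 1 -> 0 < eps ->
  vector_bpb both_le1 delta eps -> delta <= eps.
Proof.
move=> d1 eps0 Deps; rewrite leNgt; apply/negP => lt_eps.
have [x x1] := exists_unit.
have [||y [y1 _]] := Deps x ((1 - eps) *r x).
- by rewrite rnormZ x1 ger0_norm; [split|]; lra.
- by rewrite rdotZr rdotxx x1; lra.
rewrite (rnorm_lt _ (ltW eps0)) rdot_subxx !rdotE !rdotxx x1 y1.
have := rdot_CauchySchwarz x y; rewrite x1 y1; nra.
Qed.

Lemma vector_bpb_ball_ge_sqrt delta eps : 1 < delta < 2 -> 0 < eps ->
  vector_bpb both_le1 delta eps -> Num.sqrt delta <= eps.
Proof.
move=> /andP[d1 d2] eps0 Deps; rewrite leNgt; apply/negP => lt_eps.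
have eps2 : eps ^+ 2 < delta.
  rewrite -(@sqr_sqrtr _ delta); last by lra.
  by rewrite ltr_pXn2r // nnegrE ?sqrtr_ge0 ?ltW.
have [x x1] := exists_unit.
(* For [z = - s x] and unit [y], [s |x - y|^2 + |z - y|^2 = (1 + s)^2]. Both squared distances below
   [eps^2] would give [1 + s < eps^2], contrary to the choice of [s]. *)
pose s := Num.max (eps ^+ 2 - 1) 0.
have s0 : 0 <= s by rewrite le_max lexx orbT.
have sd : s < delta - 1 by rewrite gt_max; apply/andP; split; lra.
have [||y [y1]] := Deps x ((- s) *r x).
- by rewrite rnormZ x1 normrN ger0_norm //; split; lra.
- by rewrite rdotZr rdotxx x1; lra.
rewrite !(rnorm_lt _ (ltW eps0)) !rdot_subxx !rdotE !rdotxx x1 y1.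
rewrite /s; have [e1|e1] := leP (eps ^+ 2 - 1) 0; nra.
Qed.

End Dimension.

(** * Upper bounds from the angle bisector *)

Lemma bisecting_unit x z : 0 < rnorm x -> 0 < rnorm z ->
    0 < rnorm x * rnorm z + <|x, z|> ->
  exists y, [/\ rnorm y = 1,
    2 * <|x, y|> = Num.sqrt (2 * rnorm x ^+ 2 + 2 * rnorm x * (<|x, z|> / rnorm z)) &
    2 * <|z, y|> = Num.sqrt (2 * rnorm z ^+ 2 + 2 * rnorm z * (<|x, z|> / rnorm x))].
Proof.
set a := rnorm x; set b := rnorm z; set p := <|x, z|> => a0 b0 q0.
(* Both summands have length [a b], so [w] bisects the angle; [N2] is its squared norm. *)
pose w := b *r x + a *r z; pose N2 := 2 * a * b * (a * b + p).
have N2_gt0 : 0 < N2 by rewrite !mulr_gt0.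
have wE : <|w, w|> = N2.
  by rewrite /w !rdotE (rdotC z x) !rdotxx -/a -/b -/p /N2; ring.
have wN : rnorm w ^+ 2 = N2 by rewrite -rdotxx.
have w_gt0 : 0 < rnorm w by rewrite rnormE wE sqrtr_gt0.
have w0 : w != 0.
  by apply/eqP => w0; move: N2_gt0; rewrite -wE w0 /rdot linear0l re0 ltxx.
exists ((rnorm w)^-1 *r w); split; first exact: rnormalize.
- have xw : <|x, w|> = a * (a * b + p).
    by rewrite /w !rdotE !rdotxx -/a -/p; ring.
  rewrite rdotZr xw -[LHS]ger0_norm; last by rewrite !mulr_ge0 ?invr_ge0 ?ltW.
  rewrite -sqrtr_sqr !exprMn exprVn wN /N2; congr Num.sqrt; field.
  by rewrite !gt_eqF.
- have zw : <|z, w|> = b * (a * b + p).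
    by rewrite /w !rdotE (rdotC z x) !rdotxx -/b -/p; ring.
  rewrite rdotZr zw -[LHS]ger0_norm; last by rewrite !mulr_ge0 ?invr_ge0 ?ltW.
  rewrite -sqrtr_sqr !exprMn exprVn wN /N2; congr Num.sqrt; field.
  by rewrite !gt_eqF.
Qed.

Lemma bpb_radius_gt0 (delta : R) : 0 < delta < 2 ->
  0 < 2 - Num.sqrt (4 - 2 * delta).
Proof.
move=> /andP[d0 d2]; rewrite subr_gt0 -[ltRHS]ger0_norm // -sqrtr_sqr.
by rewrite ltr_sqrt ?exprn_gt0 //; lra.
Qed.

(** The left side is the squared distance from the bisector to either unit vector, and the right
    side is its value at the excluded [p = 1 - delta]. *)
Lemma bpb_radius_lt (p delta : R) : 0 < delta < 2 -> 1 - delta < p ->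
  2 - Num.sqrt (2 + 2 * p) < 2 - Num.sqrt (4 - 2 * delta).
Proof. by move=> /andP[d0 d2] dp; rewrite ltrD2l ltrN2 ltr_sqrt; lra. Qed.

Lemma vector_bpb_sphere delta : 0 < delta < 2 ->
  vector_bpb both_eq1 delta (Num.sqrt (2 - Num.sqrt (4 - 2 * delta))).
Proof.
move=> d02 x z [x1 z1] xz.
have [|||y [y1 xy zy]] := @bisecting_unit x z.
- by rewrite x1.
- by rewrite z1.
- by rewrite x1 z1; move: d02 => /andP[]; lra.
have := bpb_radius_lt d02 xz.
rewrite x1 z1 divr1 expr1n !mulr1 in xy zy.
exists y; split=> //; rewrite rnorm_lt ?sqrtr_ge0 // sqr_sqrtr ?ltW ?bpb_radius_gt0 //.
  by rewrite rdot_subxx xy !rdotxx x1 y1; lra.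
by rewrite rdot_subxx zy !rdotxx z1 y1; lra.
Qed.

(* The left-hand side is convex in [a] on [[p, 1]], since [sqrt (2a^2 + 2ap)] is
   concave there, and the maximum is over its values at the endpoints. *)
Lemma endpoint_bound (p a : R) : 0 < p -> p <= a <= 1 ->
  1 + a ^+ 2 - Num.sqrt (2 * a ^+ 2 + 2 * a * p) <=
    Num.max (2 - Num.sqrt (2 + 2 * p)) ((1 - p) ^+ 2).
Proof.
move=> p0 /andP[pa a1]; have [->|an1] := eqVneq a 1.
  by rewrite le_max expr1n !mulr1; apply/orP; left; lra.
have p1 : p < 1 by rewrite (le_lt_trans pa) // lt_neqAle an1.
set M := Num.max _ _.
have M1 : 2 - Num.sqrt (2 + 2 * p) <= M by rewrite le_max lexx.
have M2 : (1 - p) ^+ 2 <= M by rewrite le_max lexx orbT.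
set W := Num.sqrt (2 + 2 * p) in M1.
have W0 : 0 <= W by exact: sqrtr_ge0.
have WE : W ^+ 2 = 2 + 2 * p by rewrite sqr_sqrtr //; lra.
(* Since [(3 + p)^2 - 4 W^2 = (1 - p)^2]; this fixes the sign of the concavity remainder below. *)
have W3 : 2 * W <= 3 + p.
  rewrite -[leLHS]ger0_norm ?mulr_ge0 // -[leRHS]ger0_norm; last by lra.
  by rewrite -ler_sqr ?nnegrE // !real_normK ?num_real // exprMn WE;
     have := sqr_ge0 (1 - p); lra.
pose t := (a - p) / (1 - p).
have aE : a = t + (1 - t) * p by rewrite /t; field; lra.
have t0 : 0 <= t by rewrite divr_ge0; lra.
have t1 : t <= 1 by rewrite ler_pdivrMr; lra.
(* [V] is the chord of the square root between its values [2 p] at [a = p] and [W] at [a = 1]. *)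
pose V := t * W + (1 - t) * (2 * p).
have V0 : 0 <= V by rewrite /V addr_ge0 // mulr_ge0 //; lra.
have tt0 : 0 <= t * (1 - t) by rewrite mulr_ge0 //; lra.
have VW : V <= Num.sqrt (2 * a ^+ 2 + 2 * a * p).
  rewrite -[leLHS]ger0_norm // -sqrtr_sqr ler_wsqrtr // -subr_ge0.
  rewrite (_ : _ - _ = t * (1 - t) * (2 * p * (3 + p - 2 * W))).
    by rewrite mulr_ge0 // mulr_ge0; lra.
  have -> : V ^+ 2 = t ^+ 2 * W ^+ 2 + 4 * p * t * (1 - t) * W
                     + (1 - t) ^+ 2 * 4 * p ^+ 2 by rewrite /V; ring.
  by rewrite WE aE; ring.
have : a ^+ 2 <= t + (1 - t) * p ^+ 2.
  rewrite -subr_ge0 aE (_ : _ - _ = t * (1 - t) * (1 - p) ^+ 2); last by ring.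
  by rewrite mulr_ge0 ?sqr_ge0.
have : t * (2 - W) + (1 - t) * (1 - p) ^+ 2 <= t * M + (1 - t) * M.
  by rewrite lerD // ler_wpM2l //; lra.
by move: VW; rewrite /V; lra.
Qed.

Lemma vector_bpb_ball delta : 0 < delta <= 1 ->
  vector_bpb both_le1 delta
    (Num.max delta (Num.sqrt (2 - Num.sqrt (4 - 2 * delta)))).
Proof.
move=> /andP[d0 d1] x z [x1 z1] xz.
have d02 : 0 < delta < 2 by rewrite d0; lra.
have p0 : 0 < <|x, z|> by lra.
have CS := rdot_CauchySchwarz x z; have x0 := rnorm_ge0 x; have z0 := rnorm_ge0 z.
have px : <|x, z|> <= rnorm x by rewrite (le_trans CS) // ler_piMr.
have pz : <|x, z|> <= rnorm z by rewrite (le_trans CS) // ler_piMl.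
have x_gt0 := lt_le_trans p0 px; have z_gt0 := lt_le_trans p0 pz.
have [|y [y1 xy zy]] := bisecting_unit x_gt0 z_gt0.
  by rewrite ltr_wpDl // mulr_ge0.
set e := Num.max _ _.
have de : delta <= e by rewrite le_max lexx.
have radius_e : Num.sqrt (2 - Num.sqrt (4 - 2 * delta)) <= e by rewrite le_max lexx orbT.
have e0 : 0 <= e by rewrite (le_trans (ltW d0)).
have close a : <|x, z|> <= a <= 1 ->
    1 + a ^+ 2 - Num.sqrt (2 * a ^+ 2 + 2 * a * <|x, z|>) < e ^+ 2.
  move=> /(endpoint_bound p0)/le_lt_trans; apply; rewrite gt_max; apply/andP; split.
    apply: lt_le_trans (bpb_radius_lt d02 xz) _.
    rewrite -(sqr_sqrtr (ltW (bpb_radius_gt0 d02))).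
    by rewrite ler_sqr ?nnegrE ?sqrtr_ge0.
  apply: lt_le_trans (_ : delta ^+ 2 <= _).
    by rewrite ltr_pXn2r // ?nnegrE; lra.
  by rewrite ler_sqr ?nnegrE // ltW.
(* Dropping the other norm [b <= 1] lowers the root and leaves a function of [a] alone, which
   [close] controls. *)
have monotone a b : 0 <= a -> 0 < b <= 1 ->
    Num.sqrt (2 * a ^+ 2 + 2 * a * <|x, z|>) <=
    Num.sqrt (2 * a ^+ 2 + 2 * a * (<|x, z|> / b)).
  move=> a0 /andP[b0 b1]; rewrite ler_wsqrtr // lerD2l ler_wpM2l ?mulr_ge0 //.
  by rewrite ler_pdivlMr // ler_piMr // ltW.
exists y; split=> //; rewrite rnorm_lt // rdot_subxx ?xy ?zy !rdotxx y1 expr1n.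
  have := close (rnorm x); rewrite px x1 => /(_ isT).
  have := monotone (rnorm x) (rnorm z) x0; rewrite z_gt0 z1 => /(_ isT); lra.
have := close (rnorm z); rewrite pz z1 => /(_ isT).
have := monotone (rnorm z) (rnorm x) z0; rewrite x_gt0 x1 => /(_ isT); lra.
Qed.

End RealInnerProduct.

Theorem mainTheorem7 (R : realType) (k : scalar_kind)
    (H : completeNormedModType (scalars R k))
    (ip : {dot H for @scalar_conj R k})
    (norm_ip : forall x : H, `|x| ^+ 2 = ip x x)
    (dimH : real_dim_ge2 H) :
  (forall delta : R, 0 < delta < 2 ->
     spherical_bpb_modulus H delta = Num.sqrt (2 - Num.sqrt (4 - 2 * delta)))
  /\
  ((forall delta : R, 0 < delta <= 1 ->
      bpb_modulus H delta =
        Num.max delta (Num.sqrt (2 - Num.sqrt (4 - 2 * delta))))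
   /\
   (forall delta : R, 1 < delta < 2 ->
      bpb_modulus H delta = Num.sqrt delta)).
Proof.
have ballE (x : H) (f : {linear H -> (scalars R k)^o}) :
    in_balls x f <-> continuous f /\ both_le1 (rnorm x) (dual_norm f).
  by split=> [[]|[? []]].
have sphereE (x : H) (f : {linear H -> (scalars R k)^o}) :
    in_spheres x f <-> continuous f /\ both_eq1 (rnorm x) (dual_norm f).
  by split=> [[]|[? []]].
split; [|split] => delta d.
- apply: (bpb_infE norm_ip sphereE).
  + by rewrite sqrtr_gt0 bpb_radius_gt0.
  + exact: vector_bpb_sphere.
  + by move=> eps; exact: vector_bpb_sphere_ge.
- have [d0 d1] := andP d.
  apply: (bpb_infE norm_ip ballE).
  + by rewrite lt_max d0.
  + exact: vector_bpb_ball.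
  + move=> eps eps0 Deps; rewrite ge_max; apply/andP; split.
      exact: vector_bpb_ball_ge Deps.
    (* Unit vectors lie in the ball, so the spherical lower bound carries over. *)
    apply: (vector_bpb_sphere_ge norm_ip dimH _ eps0); first by rewrite d0; lra.
    by apply: vector_bpb_sub Deps => a b [-> ->].
- have d0 : 0 < delta by move: d => /andP[]; lra.
  apply: (bpb_infE norm_ip ballE).
  + by rewrite sqrtr_gt0.
  + exact: vector_bpb_ball_sqrt.
  + by move=> eps; exact: vector_bpb_ball_ge_sqrt.
Qed.
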